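(* Let $0<c_3<1/4$, $c_5\in\mathbb{R}$, $b_2=\frac{1-\sqrt{1-4c_3}}{2}$, $b_3=\frac{1+\sqrt{1-4c_3}}{2}$. For $b_2\le\alpha\le b_3$ put $$J(\alpha)=\int_{b_2}^{\alpha}\frac{(c_3+\rho^2)^{2m-1}}{\{\rho^{2m}-(c_3+\rho^2)^{2m}\}^{\frac{2m-1}{2m}}}\,d\rho$$ (a finite, strictly increasing function) and $d_2=J(b_3)>0$. Define $\hat\alpha:[c_5-d_2,c_5+d_2]\to[b_2,b_3]$ by letting $\hat\alpha(u)$ be the unique $\alpha\in[b_2,b_3]$ with $J(\alpha)=|u-c_5|$, and extend it to $\alpha^*:\mathbb{R}\to[b_2,b_3]$ by $\alpha^*(u+2kd_2)=\hat\alpha(u)$ for $u\in[c_5-d_2,c_5+d_2]$, $k\in\mathbb{Z}$. Then $\alpha^*$ is a well-defined, $2d_2$-periodic $C^2$ function on $\mathbb{R}$, and the rotational surface $$f^*(u,v)=(\alpha^*(u)\cos v,\ \alpha^*(u)\sin v,\ u),\qquad (u,v)\in\mathbb{R}\times[0,2\pi],$$ has a Birkhoff–Gauss map that is $C^1$ on the whole domain (with orientation: $\nabla\Phi(\eta)$ is a positive multiple of $f^*_u\times f^*_v$) and has constant Minkowski mean curvature $-1$.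
   Context: Fix an integer $m\ge 2$. Let $\Phi(x_1,x_2,x_3)=(x_1^2+x_2^2)^m+x_3^{2m}$ and let $\|\cdot\|$ be the norm on $\mathbb{R}^3$ whose unit sphere is $S=\{x\in\mathbb{R}^3:\Phi(x)=1\}$ (a smooth, strictly convex surface). For a surface given by a parametrization $f(s,v)$, its Birkhoff–Gauss map $\eta$ is the map into $S$ defined by requiring $\eta\in S$ and $\nabla\Phi(\eta)=\mu\, f_s\times f_v$ for some function $\mu>0$, where $\times$ is the standard cross product (so the tangent plane of $S$ at $\eta(p)$ is parallel to $T_pM$, and $d\eta_p$ is an endomorphism of $T_pM$). Where $\eta$ is $C^1$, the Minkowski mean curvature is $H=\tfrac12\operatorname{trace}(d\eta_p)$. *)

(* Defs.v *)
From HB Require Import structures.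
From mathcomp Require Import all_boot all_order all_algebra.
From mathcomp Require Import all_classical all_reals all_analysis.
Set Implicit Arguments. Unset Strict Implicit. Unset Printing Implicit Defensive.
Import Order.TTheory GRing.Theory Num.Theory.
Import numFieldNormedType.Exports.
Local Open Scope classical_set_scope.
Local Open Scope ring_scope.

Section Defs.
Variable R : realType.

Definition v3 := (R * R * R)%type.
Definition mkv3 (x1 x2 x3 : R) : v3 := (x1, x2, x3).
Definition c1 (x : v3) := x.1.1.
Definition c2 (x : v3) := x.1.2.
Definition c3v (x : v3) := x.2.
Definition addv3 (x y : v3) : v3 := mkv3 (c1 x + c1 y) (c2 x + c2 y) (c3v x + c3v y).
Definition scalev3 (a : R) (x : v3) : v3 := mkv3 (a * c1 x) (a * c2 x) (a * c3v x).
Definition cross (x y : v3) : v3 :=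
  mkv3 (c2 x * c3v y - c3v x * c2 y)
       (c3v x * c1 y - c1 x * c3v y)
       (c1 x * c2 y - c2 x * c1 y).

Definition Phi (m : nat) (x : v3) : R :=
  (c1 x ^+ 2 + c2 x ^+ 2) ^+ m + c3v x ^+ (2 * m).
Definition gradPhi (m : nat) (x : v3) : v3 :=
  mkv3 ((2 * m)%:R * (c1 x ^+ 2 + c2 x ^+ 2) ^+ m.-1 * c1 x)
       ((2 * m)%:R * (c1 x ^+ 2 + c2 x ^+ 2) ^+ m.-1 * c2 x)
       ((2 * m)%:R * c3v x ^+ (2 * m).-1).

Definition b2 (c3 : R) : R := (1 - Num.sqrt (1 - 4 * c3)) / 2.
Definition b3 (c3 : R) : R := (1 + Num.sqrt (1 - 4 * c3)) / 2.

Definition Jintegrand (m : nat) (c3 : R) (rho : R) : R :=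
  (c3 + rho ^+ 2) ^+ (2 * m).-1 /
  powR (rho ^+ (2 * m) - (c3 + rho ^+ 2) ^+ (2 * m))
       ((2 * m).-1%:R / (2 * m)%:R).

(* J(alpha) as a (Lebesgue, hence possibly improper) integral in \bar R *)
Definition Jbar (m : nat) (c3 : R) (alpha : R) : \bar R :=
  (\int[@lebesgue_measure R]_(rho in `[b2 c3, alpha])
     (Jintegrand m c3 rho)%:E)%E.
(* its real value (meaningful where Jbar is finite) *)
Definition J (m : nat) (c3 : R) (alpha : R) : R := fine (Jbar m c3 alpha).
Definition d2 (m : nat) (c3 : R) : R := J m c3 (b3 c3).

(* alpha* satisfies the defining prescription alpha*(u + 2 k d2) = hat-alpha(u),
   hat-alpha(u) being the alpha in [b2,b3] with J(alpha) = |u - c5| *)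
Definition alpha_star_spec (m : nat) (c3 c5 : R) (a : R -> R) : Prop :=
  forall (u : R) (k : int), c5 - d2 m c3 <= u <= c5 + d2 m c3 ->
    b2 c3 <= a (u + 2 * k%:~R * d2 m c3) <= b3 c3 /\
    J m c3 (a (u + 2 * k%:~R * d2 m c3)) = `|u - c5|.

Definition C2fun (a : R -> R) : Prop :=
  (forall x, derivable a x 1) /\
  (forall x, derivable (derive1 a) x 1) /\
  continuous (derive1 (derive1 a)).

Definition fstar (a : R -> R) (u v : R) : v3 :=
  mkv3 (a u * cos v) (a u * sin v) u.

Definition pu (f : R -> R -> v3) (u v : R) : v3 :=
  mkv3 (derive1 (fun t => c1 (f t v)) u)
       (derive1 (fun t => c2 (f t v)) u)
       (derive1 (fun t => c3v (f t v)) u).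
Definition pv (f : R -> R -> v3) (u v : R) : v3 :=
  mkv3 (derive1 (fun t => c1 (f u t)) v)
       (derive1 (fun t => c2 (f u t)) v)
       (derive1 (fun t => c3v (f u t)) v).

Definition C1_2d (g : R -> R -> R) : Prop :=
  (forall u v, derivable (fun t => g t v) u 1) /\
  (forall u v, derivable (fun t => g u t) v 1) /\
  continuous (fun p : R * R => derive1 (fun t => g t p.2) p.1) /\
  continuous (fun p : R * R => derive1 (fun t => g p.1 t) p.2).

Definition C1_map (eta : R -> R -> v3) : Prop :=
  C1_2d (fun u v => c1 (eta u v)) /\
  C1_2d (fun u v => c2 (eta u v)) /\
  C1_2d (fun u v => c3v (eta u v)).

Definition is_BG_map (m : nat) (f : R -> R -> v3) (eta : R -> R -> v3) : Prop :=
  forall u v, Phi m (eta u v) = 1 /\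
    exists mu : R, 0 < mu /\
      gradPhi m (eta u v) = scalev3 mu (cross (pu f u v) (pv f u v)).

(* Minkowski mean curvature H = 1/2 trace(d eta_p), d eta_p being the
   endomorphism of T_pM = span(f_u, f_v) sending f_u |-> eta_u, f_v |-> eta_v *)
Definition mink_mean_curv (f eta : R -> R -> v3) (u v H : R) : Prop :=
  exists a b c d : R,
    pu eta u v = addv3 (scalev3 a (pu f u v)) (scalev3 b (pv f u v)) /\
    pv eta u v = addv3 (scalev3 c (pu f u v)) (scalev3 d (pv f u v)) /\
    H = (a + d) / 2.

End Defs.

(* Main.v *)
Require Import Defs.
From HB Require Import structures.
From mathcomp Require Import all_boot all_order all_algebra.
From mathcomp Require Import all_classical all_reals all_analysis.
From mathcomp Require Import measurable_realfun ring lra.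
Set Implicit Arguments. Unset Strict Implicit. Unset Printing Implicit Defensive.
Import Order.TTheory GRing.Theory Num.Theory.
Import numFieldNormedType.Exports.
Local Open Scope classical_set_scope.
Local Open Scope ring_scope.

(** Write N = 2m, r(rho) = (c3 + rho^2)/rho and z(rho) = (1 - r(rho)^N)^(1/N).
    On [b2,b3] one has 0 < r <= 1, with r = 1 exactly at the endpoints, and the
    integrand of J is (r/z)^(N-1).  Hence, as long as the profile alpha is strictly
    monotone, the pair (alpha, z) with z = +-z(alpha) solves the smooth system
      alpha' = (z / r(alpha))^(N-1),   z' = c3/alpha^2 - 1,
    whose first integral is r(alpha)^N + z^N = 1.  Both sides being continuous,
    the system also holds at the turning points, so alpha is C^2.  The
    Birkhoff-Gauss map is eta = (-r cos v, -r sin v, z); it satisfies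
    eta_u = z' f_u and eta_v = -(r/alpha) f_v, and z' - r/alpha = -2.

    J is finite because its integrand is dominated by the derivative of a
    continuous function (Jintegrand_le_derivative).  Since |u - c5| on the
    fundamental interval is recovered from cos(pi (u - c5)/d2), the periodic
    extension is alpha(u) = K^-1(cos(pi (u - c5)/d2)) with
    K = cos(pi J/d2) : [b2,b3] -> [-1,1], without any case distinction. *)

(** * Real analysis *)

Section Generic.
Context {R : realType}.
Implicit Types (f g F : R -> R) (a b x : R).

Lemma ge0_derivative_le f F a b :
  (forall x, x \in `]a, b[ -> 0 <= f x) ->
  (forall x, x \in `]a, b[ -> is_derive x 1 F (f x)) ->
  {within `[a, b], continuous F} ->
  forall x y, a <= x -> x <= y -> y <= b -> F x <= F y.
Proof.
move=> f0 dF cF x y ax + yb.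
rewrite le_eqVlt => /predU1P[->//|xy].
have dFxy t : t \in `]x, y[ -> is_derive t 1 F (f t).
  rewrite in_itv/= => /andP[xt ty]; apply: dF; rewrite in_itv/=.
  by rewrite (le_lt_trans ax)// (lt_le_trans ty).
have cFxy : {within `[x, y], continuous F}.
  by apply: continuous_subspaceW cF; apply: subset_itv; rewrite bnd_simp.
have [c + Fc] := MVT xy dFxy cFxy.
rewrite in_itv/= => /andP[xc cy]; rewrite -subr_ge0 Fc.
rewrite mulr_ge0 ?subr_ge0 ?(ltW xy)// f0// in_itv/=.
by rewrite (le_lt_trans ax)// (lt_le_trans cy).
Qed.

(** Since [f] may blow up at both ends, the fundamental theorem is applied on the shrunken intervals
    [[a + e k, b - e k]]. There the integral is at most [F b - F a] because [F] is nondecreasing,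
    and monotone convergence carries the bound over to the whole interval. *)
Lemma integral_primitive_le f F a b : a < b ->
  {in `]a, b[, continuous f} ->
  (forall x, x \in `]a, b[ -> 0 <= f x) ->
  (forall x, x \in `]a, b[ -> is_derive x 1 F (f x)) ->
  {within `[a, b], continuous F} ->
  (\int[@lebesgue_measure R]_(x in `[a, b]) (f x)%:E <= (F b - F a)%:E)%E.
Proof.
move=> ab cf f0 dF cF.
(* A denominator of at least 3 gives [2 * e k < b - a], so every shrunken interval is
   nondegenerate. *)
pose e (k : nat) : R := (b - a) / k.+3%:R.
have e0 k : 0 < e k by rewrite divr_gt0// subr_gt0.
have e2 k : e k * 2 < b - a.
  rewrite /e -mulrA -[ltRHS]mulr1 ltr_pM2l ?subr_gt0//.
  by rewrite mulrC ltr_pdivrMr// mul1r ltr_nat.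
have eS k l : (k <= l)%N -> e l <= e k.
  by move=> kl; rewrite ler_pM2l ?subr_gt0// lef_pV2 ?posrE// ler_nat.
pose E (k : nat) : set R := `[a + e k, b - e k]%classic.
have subE k x : E k x -> x \in `]a, b[.
  rewrite /E/= !in_itv/= => /andP[h1 h2]; apply/andP; split.
    by apply: lt_le_trans h1; rewrite ltrDl.
  by apply: le_lt_trans h2 _; rewrite gtrBl.
have ooE k x : x \in `]a + e k, b - e k[ -> E k x.
  by rewrite /E/= !in_itv/= => /andP[/ltW-> /ltW->].
have EU : \bigcup_k E k = `]a, b[%classic.
  apply/seteqP; split=> [x [k _]|x]; first exact: subE.
  rewrite /= in_itv/= => /andP[ax xb].
  pose d := Num.min (x - a) (b - x).
  have d0 : 0 < d by rewrite lt_min !subr_gt0 ax.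
  pose k := Num.bound ((b - a) / d).
  have ed : e k <= d.
    rewrite ler_pdivrMr// mulrC -ler_pdivrMr//.
    apply: (le_trans (ltW (archi_boundP _))).
      by rewrite divr_ge0 ?subr_ge0 ?ltW.
    by rewrite ler_nat /k; do 3 apply: leqW.
  exists k => //; rewrite /E/= in_itv/=.
  have h1 : d <= x - a by rewrite ge_min lexx.
  have h2 : d <= b - x by rewrite ge_min lexx orbT.
  by apply/andP; split; lra.
have mf : measurable_fun `]a, b[ f.
  apply: open_continuous_measurable_fun.
    exact: interval_open.
  by move=> x; rewrite inE/=; exact: cf.
rewrite integral_itv_bndoo -?EU; last first.
  by rewrite EU; exact/measurable_EFinP.
have cvgE : (\int[@lebesgue_measure R]_(x in E k) (f x)%:E @[k --> \oo] -->
    \int[@lebesgue_measure R]_(x in \bigcup_k E k) (f x)%:E)%E.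
  apply: ge0_nondecreasing_set_cvg_integral => //.
  - move=> k l kl; rewrite subsetEset => x.
    rewrite /E/= !in_itv/= => /andP[h1 h2].
    by have := eS _ _ kl => h3; apply/andP; split; lra.
  - by move=> k; exact: measurable_itv.
  - move=> k; apply/measurable_EFinP; apply: measurable_funS mf => // x; exact: subE.
  - by move=> k x Ekx; rewrite lee_fin f0// (subE k).
rewrite -(cvg_lim _ cvgE)//; apply: lime_le.
  by apply/cvg_ex; eexists; exact: cvgE.
apply: nearW => k.
have kab : a + e k < b - e k by have := e2 k; lra.
have cFk x : x \in `]a, b[ -> {for x, continuous F}.
  by move=> xab; apply: within_continuous_continuous xab.
have ka : a < a + e k by rewrite ltrDl.
have kb : b - e k < b by rewrite gtrBl.
rewrite (@continuous_FTC2 R f F); first last.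
- move=> x xk; rewrite derive1E.
  have xab : x \in `]a, b[ by exact: (subE k) (ooE k _ xk).
  by have [_ ->] := dF _ xab.
- split=> [x xk||].
  + have xab : x \in `]a, b[ by exact: (subE k) (ooE k _ xk).
    by have [] := dF _ xab.
  + by apply: cvg_at_right_filter; apply: cFk; apply: (subE k);
    rewrite /E/= in_itv/= lexx ltW.
  + by apply: cvg_at_left_filter; apply: cFk; apply: (subE k);
    rewrite /E/= in_itv/= lexx ltW.
- apply: continuous_in_subspaceT => x; rewrite inE => xk; apply: cf; exact: (subE k).
- by [].
rewrite -EFinB lee_fin.
have mono := ge0_derivative_le f0 dF cF.
have h1 := mono a (a + e k) (lexx _) (ltW ka) ltac:(by rewrite ltW// (lt_trans kab)).
have h2 := mono (b - e k) b ltac:(by rewrite ltW// (lt_trans ka)) (ltW kb) (lexx _).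
exact: lerB.
Qed.

(** By the mean value theorem each difference quotient at [x] is a value of [g] at a nearby point
    other than [x], hence tends to [g x]. This is the tool that carries the differential equations
    across the turning points. *)
Lemma continuous_is_derive f g x : {for x, continuous f} ->
  {for x, continuous g} -> (\forall y \near x^', is_derive (y : R) 1 f (g y)) ->
  is_derive x 1 f (g x).
Proof.
move=> cf cg dfg; apply/is_derive1_caratheodory.
pose h z := if z == x then g x else (f z - f x) / (z - x).
have hx : h x = g x by rewrite /h eqxx.
exists h; split=> //.
- move=> z; rewrite /h; case: eqP => [->|/eqP zx]; first by rewrite !subrr mulr0.
  by rewrite divfK// subr_eq0.
- suff : h z @[z --> x] --> g x by rewrite -hx.
  apply/cvgrPdist_lt => e e0.
  have [d1 /= d10 Hd1] := (cvgrPdist_lt _ _).1 cg e e0.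
  move: dfg; rewrite near_withinE => -[d2 /= d20 Hd2].
  pose d := Num.min d1 d2.
  have d0 : 0 < d by rewrite lt_min d10 d20.
  exists d => //= z; rewrite /ball/= => xz.
  (* Letting [x] be either endpoint treats left and right quotients at once; the mean value point is
     interior, so it differs from [x]. *)
  have main u v : u < v -> (u = x \/ v = x) -> `|u - v| < d ->
      `|g x - (f v - f u) / (v - u)| < e.
    move=> uv uvx; rewrite ltr0_norm ?subr_lt0// opprB => uvd.
    have near_x t : u <= t <= v -> `|x - t| < d.
      move=> /andP[ut tv]; rewrite ltr_norml; case: uvx => <-; apply/andP; split; lra.
    have dft t : u <= t <= v -> t != x -> is_derive t 1 f (g t).
      move=> tuv tx; apply: Hd2 => //.
      by rewrite /= (lt_le_trans (near_x t _)) ?ge_min ?lexx ?orbT.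
    have in_oo t : t \in `]u, v[ -> is_derive t 1 f (g t).
      rewrite in_itv/= => /andP[ut tv]; apply: dft; first by rewrite !ltW.
      by case: uvx => <-; [rewrite gt_eqF|rewrite lt_eqF].
    have cuvf : {within `[u, v], continuous f}.
      apply/subspace_continuousP => t /=; rewrite in_itv/= => tuv.
      apply: cvg_within_filter; have [->//|tx] := eqVneq t x.
      by have [+ _] := dft _ tuv tx => /derivable1_diffP/differentiable_continuous.
    have [c cuv ->] := MVT uv in_oo cuvf.
    rewrite mulfK ?subr_eq0 ?gt_eqF//; apply: Hd1.
    rewrite /= (lt_le_trans (near_x c _)) ?ge_min ?lexx//.
    by move: cuv; rewrite in_itv/= => /andP[/ltW-> /ltW->].
  rewrite /h; case: eqP => [_|/eqP]; first by rewrite subrr normr0.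
  rewrite neq_lt => /orP[zx|zx].
  + have := main z x zx (or_intror erefl); rewrite distrC => /(_ xz).
    by rewrite -[f x - f z]opprB -[x - z]opprB invrN mulrNN.
  + by have := main x z zx (or_introl erefl) xz.
Qed.

(** One-sided continuity of [f] at [a] and [b] suffices because [g] never leaves the segment. It
    serves for [Jcos_inv] composed with a cosine, which does reach the ends. *)
Lemma within_continuous_comp (f g : R -> R) a b :
  {within `[a, b], continuous f} -> continuous g ->
  (forall x, g x \in `[a, b]) -> continuous (f \o g).
Proof.
move=> /subspace_continuousP cf cg gab x.
apply: (@cvg_comp _ _ _ _ f _ (within `[a, b]%classic (nbhs (g x)))); last first.
  by apply: cf; exact: gab.
move=> A Aw; apply: (@filterS _ (nbhs x) _ _ _ _ (cg x _ Aw)) => y /=.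
by move=> /(_ (gab y)).
Qed.

(* Truncation below makes the real power continuous on the whole line. *)
Lemma continuous_powR_max0 (p : R) : 0 < p ->
  continuous (fun x : R => (Num.max x 0) `^ p).
Proof.
move=> p0 x; have [x0|x0] := ltP 0 x.
  have [/derivable1_diffP/differentiable_continuous + _] := is_derive1_powR p x0.
  rewrite /continuous_at [in X in _ -> _ --> X]max_l ?ltW//.
  apply: cvg_trans; apply: near_eq_cvg; near=> y; rewrite max_l// ltW//.
  by near: y; exact: lt_nbhsr.
rewrite /continuous_at [in X in _ --> X]max_r// powR0 ?gt_eqF//.
(* This choice gives [d ^ p = e / 2 < e]. *)
apply/cvgrPdist_lt => e e0; pose d := (e / 2) `^ p^-1.
have d0 : 0 < d by rewrite powR_gt0 ?divr_gt0.
near=> y; rewrite sub0r normrN ger0_norm ?powR_ge0//.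
have yd : Num.max y 0 <= d.
  rewrite ge_max (ltW d0) andbT ltW//; near: y; apply: lt_nbhsl.
  exact: le_lt_trans d0.
have : Num.max y 0 `^ p <= d `^ p.
  by apply: ge0_ler_powR => //; rewrite ?nnegrE ?(ltW p0) ?(ltW d0)// le_max lexx orbT.
rewrite /d -powRrM mulVf ?gt_eqF// powRr1 ?divr_ge0 // ?(ltW e0)//.
by move=> h; rewrite (le_lt_trans h)// ltr_pdivrMr// mulr_natr mulr2n ltrDl.
Unshelve. all: by end_near. Qed.

End Generic.

Lemma is_derive_powR_max0 (R : realType) (p x : R) : 0 < x ->
  is_derive x 1 (fun y : R => (Num.max y 0) `^ p) (p * x `^ (p - 1)).
Proof.
move=> x0; apply: near_eq_is_derive (is_derive1_powR p x0).
by near=> y; rewrite max_l// ltW//; near: y; exact: lt_nbhsr.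
Unshelve. all: by end_near. Qed.

Lemma is_derive_exp (R : realType) (f : R -> R) (n : nat) (x df : R) :
  is_derive x 1 f df ->
  is_derive x 1 (fun y => f y ^+ n) (n%:R * f x ^+ n.-1 * df).
Proof.
move=> fdf; have -> : (fun y => f y ^+ n) = f ^+ n.
  by apply/funext => y; rewrite exprfctE.
exact: is_deriveX.
Qed.

(** At a zero [x] of the sine, the addition formula leaves [sin y = sin (y - x) * cos x], where
    [cos x] is 1 or -1 and the first factor is nonzero for [0 < |y - x| < pi]. Elsewhere continuity
    is enough. *)
Lemma sin_neq0_dnbhs (R : realType) (x : R) : \forall y \near x^', sin y != 0.
Proof.
rewrite near_withinE; have [sx0|sx0] := eqVneq (sin x) 0.
  exists pi => /=; first exact: pi_gt0.
  move=> y /=; rewrite /ball_/= => xy yx.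
  rewrite -[y](subrK x) sinD sx0 mulr0 addr0 mulf_eq0 negb_or.
  have -> : cos x != 0.
    by rewrite -normr_eq0 (sin0cos1 sx0) oner_neq0.
  rewrite andbT; have [yx'|yx'] := ltP x y.
    rewrite gt_eqF// sin_gt0_pi// subr_gt0 yx'/=.
    by rewrite -[ltLHS]gtr0_norm ?subr_gt0// distrC.
  have xy' : 0 < x - y by rewrite subr_gt0 lt_neqAle yx.
  by rewrite -opprB sinN oppr_eq0 gt_eqF// sin_gt0_pi// xy'/= -[ltLHS]gtr0_norm.
near=> y => _; near: y.
by apply: (cvgr_neq0 (sin x)) => //; exact: continuous_sin.
Unshelve. all: by end_near. Qed.

Lemma cosD2pi_int (R : realType) (x : R) (k : int) :
  cos (x + 2 * k%:~R * pi) = cos x.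
Proof.
have cosDn (y : R) n : cos (y + 2 * n%:R * pi) = cos y.
  rewrite -(periodicn (@cosD2pi R) n y); congr (cos (_ + _)).
  by rewrite -mulr_natr -[pi *+ 2]mulr_natr; ring.
case: k => n; first exact: cosDn.
rewrite -[LHS](cosDn _ n.+1) NegzE; congr cos.
by rewrite mulrNz -pmulrn; ring.
Qed.

Lemma is_derive_derive1 (R : realType) (f : R -> R) (x d : R) :
  is_derive x 1 f d -> derive1 f x = d.
Proof. by move=> [_ <-]; rewrite derive1E. Qed.

Lemma is_derive_continuous (R : realType) (f : R -> R) (x d : R) :
  is_derive x 1 f d -> {for x, continuous f}.
Proof. by move=> [/derivable1_diffP/differentiable_continuous]. Qed.

(** Equal powers force [x = y] or [x = - y]; in the second case oddness gives [y ^+ n = 0]. It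
    recovers the third coordinate of a Gauss map from the third component of [gradPhi]. *)
Lemma expr_odd_inj (R : realDomainType) (n : nat) (x y : R) :
  odd n -> x ^+ n = y ^+ n -> x = y.
Proof.
move=> on xy; have n0 : (0 < n)%N by case: n on {xy}.
have : `|x| == `|y| by rewrite -(@eqrXn2 _ n)// -!normrX xy.
rewrite eqr_norm2 => /orP[/eqP//|/eqP xNy]; move: xy.
rewrite xNy exprNn -signr_odd on expr1 mulN1r => /eqP.
by rewrite eq_sym -addr_eq0 -mulr2n mulrn_eq0/= expf_eq0 n0/= => /eqP->; rewrite oppr0.
Qed.

(** On a rotational surface each coordinate of the Gauss map is a function of [u] times a function
    of [v]. *)
Lemma C1_2d_mul (R : realType) (A dA B dB : R -> R) :
  (forall u : R, is_derive u 1 A (dA u)) ->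
  (forall v : R, is_derive v 1 B (dB v)) ->
  continuous dA -> continuous dB -> C1_2d (fun u v => A u * B v).
Proof.
move=> hA hB cdA cdB.
have du (u v : R) : is_derive u 1 (fun t => A t * B v) (dA u * B v).
  by have := hA u => ?; apply: is_derive_eq; rewrite /GRing.scale/=; ring.
have dv (u v : R) : is_derive v 1 (fun t => A u * B t) (A u * dB v).
  by have := hB v => ?; apply: is_derive_eq; rewrite /GRing.scale/=; ring.
have cA (u : R) : {for u, continuous A} by exact: is_derive_continuous (hA u).
have cB (v : R) : {for v, continuous B} by exact: is_derive_continuous (hB v).
have c_fst (f : R -> R) : continuous f -> continuous (fun p : R * R => f p.1).
  move=> cf p; apply: (@continuous_comp _ _ _ (fst : R * R -> R) f); last exact: cf.
  exact: cvg_fst.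
have c_snd (f : R -> R) : continuous f -> continuous (fun p : R * R => f p.2).
  move=> cf p; apply: (@continuous_comp _ _ _ (snd : R * R -> R) f); last exact: cf.
  exact: cvg_snd.
split; [|split; [|split]].
- by move=> u v; case: (du u v).
- by move=> u v; case: (dv u v).
- rewrite [X in continuous X](_ : _ = fun p : R * R => dA p.1 * B p.2).
    by move=> p; apply: cvgM; [exact: c_fst|exact: c_snd].
  by apply/funext => p; rewrite (is_derive_derive1 (du _ _)).
- rewrite [X in continuous X](_ : _ = fun p : R * R => A p.1 * dB p.2).
    by move=> p; apply: cvgM; [exact: c_fst|exact: c_snd].
  by apply/funext => p; rewrite (is_derive_derive1 (dv _ _)).
Qed.

(** * The profile functions *)

(** Distance from the axis of the Gauss image of a surface point that lies at distance [rho] from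
    the axis. *)
Definition radius {R : realType} (c rho : R) : R := (c + rho ^+ 2) / rho.

(** Third coordinate of that Gauss image, up to sign. Truncation at 0 keeps it continuous on both
    sides of [b2] and [b3], where the base changes sign. *)
Definition height {R : realType} (m : nat) (c rho : R) : R :=
  (Num.max (1 - radius c rho ^+ (2 * m)) 0) `^ (2 * m)%:R^-1.

Section Profile.
Context {R : realType} (m : nat) (c : R).
Hypotheses (m0 : (0 < m)%N) (c0 : 0 < c) (c14 : c < 4^-1).
Implicit Types (rho x y : R).

Local Notation N := (2 * m)%N.
Local Notation b2 := (b2 c).
Local Notation b3 := (b3 c).
Local Notation h := (Jintegrand m c).

Let N0 : (0 < N)%N. Proof. by rewrite muln_gt0. Qed.

(** [b2] and [b3] are the roots of [t ^ 2 - t + c]; the sum and product stand in for the square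
    roots from here on. *)
Lemma b2b3 : [/\ 0 < b2, b2 < b3, b2 + b3 = 1 & b2 * b3 = c].
Proof.
have d0 : 0 < 1 - 4 * c by rewrite subr_gt0 mulrC -ltr_pdivlMr ?mul1r.
have s0 : 0 < Num.sqrt (1 - 4 * c) by rewrite sqrtr_gt0.
have s2 := sqr_sqrtr (ltW d0).
have s1 : Num.sqrt (1 - 4 * c) < 1.
  by rewrite -[ltRHS]sqrtr1 ltr_sqrt//; move: c0; lra.
rewrite /Defs.b2 /Defs.b3; move: (Num.sqrt _) s0 s2 s1 => s s0 s2 s1.
by split; nra.
Qed.

(** The upper bound is [rho - (c + rho ^ 2) = (rho - b2) * (b3 - rho) >= 0]. *)
Lemma radius_le1 rho : b2 <= rho <= b3 -> 0 < radius c rho <= 1.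
Proof.
have [b20 b23 bs bp] := b2b3 => /andP[h1 h2].
have r0 : 0 < rho by exact: lt_le_trans h1.
rewrite /radius divr_gt0 ?addr_gt0 ?exprn_gt0//=.
by rewrite ler_pdivrMr// mul1r -bp -[leRHS]mul1r -bs; nra.
Qed.

Lemma radius_lt1 rho : b2 < rho < b3 -> radius c rho < 1.
Proof.
have [b20 b23 bs bp] := b2b3 => /andP[h1 h2].
have r0 : 0 < rho by exact: lt_trans h1.
by rewrite /radius ltr_pdivrMr// mul1r -bp -[ltRHS]mul1r -bs; nra.
Qed.


Lemma height_ge0 rho : 0 <= height m c rho.
Proof. exact: powR_ge0. Qed.

Lemma height_exp rho : b2 <= rho <= b3 ->
  height m c rho ^+ N + radius c rho ^+ N = 1.
Proof.
move=> /radius_le1/andP[r0 r1].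
have p0 : 0 <= 1 - radius c rho ^+ N by rewrite subr_ge0 exprn_ile1// ltW.
rewrite /height max_l// -powR_mulrn ?powR_ge0// -powRrM mulVf ?pnatr_eq0 -?lt0n//.
by rewrite powRr1// subrK.
Qed.

Lemma height_le1 rho : b2 <= rho <= b3 -> height m c rho <= 1.
Proof.
move=> rb; have := height_exp rb; have /andP[r0 r1] := radius_le1 rb.
move=> e; rewrite -(@expr_le1 _ N) ?height_ge0//.
by rewrite -e lerDl exprn_ge0// ltW.
Qed.

Lemma height_gt0 rho : b2 < rho < b3 -> 0 < height m c rho.
Proof.
move=> rb; apply: powR_gt0; rewrite lt_max subr_gt0.
have /andP[h1 h2] := rb.
have /andP[r0 _] : 0 < radius c rho <= 1 by apply: radius_le1; rewrite !ltW.
by rewrite exprn_ilt1 ?(ltW r0) ?radius_lt1// -lt0n N0.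
Qed.

Lemma radius1_height0 rho : radius c rho = 1 -> height m c rho = 0.
Proof.
by move=> r1; rewrite /height r1 expr1n subrr maxxx powR0// invr_eq0 pnatr_eq0 -lt0n.
Qed.

Lemma height_b2 : height m c b2 = 0.
Proof.
have [b20 b23 bs bp] := b2b3; apply: radius1_height0; rewrite /radius.
by rewrite -{1}bp expr2 -mulrDr [_ + b2]addrC bs mulr1 divff ?gt_eqF.
Qed.

Lemma height_b3 : height m c b3 = 0.
Proof.
have [b20 b23 bs bp] := b2b3; apply: radius1_height0; rewrite /radius.
by rewrite -{1}bp expr2 -mulrDl bs mul1r divff// gt_eqF// (lt_trans b20).
Qed.

(** The radicand factors as [rho ^ N * (1 - radius ^ N)], so its power [(N - 1) / N] is
    [(rho * height) ^ (N - 1)]. At the two endpoints both sides are 0, since the inverse of 0 is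
    0. *)
Lemma JintegrandE rho : b2 <= rho <= b3 ->
  h rho = (radius c rho / height m c rho) ^+ N.-1.
Proof.
move=> rb; have [b20 _ _ _] := b2b3.
have r0 : 0 < rho by case/andP: rb => + _; exact: lt_le_trans.
have /andP[rr0 rr1] := radius_le1 rb.
have p0 : 0 <= 1 - radius c rho ^+ N by rewrite subr_ge0 exprn_ile1// ltW.
have E : rho ^+ N - (c + rho ^+ 2) ^+ N = rho ^+ N * (1 - radius c rho ^+ N).
  by rewrite /radius expr_div_n mulrBr mulr1 mulrCA divff ?mulr1// expf_neq0// gt_eqF.
rewrite /Jintegrand E [N.-1%:R / _]mulrC powRrM powR_mulrn ?powR_ge0//.
rewrite powRM ?exprn_ge0 ?(ltW r0)// -[rho ^+ N]powR_mulrn ?(ltW r0)// -powRrM.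
rewrite divff ?pnatr_eq0 -?lt0n// powRr1 ?(ltW r0)//.
have -> : (1 - radius c rho ^+ N) `^ N%:R^-1 = height m c rho by rewrite /height max_l.
rewrite -expr_div_n; congr (_ ^+ _); rewrite /radius invfM mulrA//.
Qed.

Lemma Jintegrand_gt0 rho : b2 < rho < b3 -> 0 < h rho.
Proof.
move=> rb; have rb' : b2 <= rho <= b3 by case/andP: rb => /ltW-> /ltW->.
have /andP[rr0 rr1] := radius_le1 rb'.
by rewrite JintegrandE// exprn_gt0// divr_gt0 ?height_gt0.
Qed.

Lemma Jintegrand_ge0 rho : b2 <= rho <= b3 -> 0 <= h rho.
Proof.
move=> rb; have /andP[rr0 rr1] := radius_le1 rb.
by rewrite JintegrandE// exprn_ge0// divr_ge0 ?height_ge0 ?ltW.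
Qed.

Lemma is_derive_radius rho : rho != 0 ->
  is_derive rho 1 (radius c) (1 - c / rho ^+ 2).
Proof.
move=> r0; rewrite /radius.
have dV : is_derive rho 1 (fun y : R => y^-1) (- rho ^- 2 *: 1).
  by apply: is_deriveV => //; exact: is_derive_id.
apply: is_derive_eq. rewrite /GRing.scale/=.
by field.
Qed.

(** Differentiating [(1 - r ^ N) ^ (1 / N)] gives [- r' * (r / height) ^ (N - 1)], and that power is
    the integrand. *)
Lemma is_derive_height rho : b2 < rho < b3 ->
  is_derive rho 1 (height m c) ((c / rho ^+ 2 - 1) * h rho).
Proof.
move=> rb; have rb' : b2 <= rho <= b3 by case/andP: rb => /ltW-> /ltW->.
have [b20 _ _ _] := b2b3.
have r0 : rho != 0 by rewrite gt_eqF//; case/andP: rb => + _; exact: lt_trans.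
have /andP[rr0 rr1] := radius_le1 rb'.
have p0 : 0 < 1 - radius c rho ^+ N.
  by rewrite subr_gt0 exprn_ilt1 ?radius_lt1 ?(ltW rr0)// -?lt0n.
have d1 := is_derive_radius r0.
have d2 : is_derive rho 1 (fun y => 1 - radius c y ^+ N) _ :=
  is_deriveB (is_derive_cst (1 : R) rho 1) (is_derive_exp N d1).
have d3 := is_derive_powR_max0 N%:R^-1 p0.
have d4 : is_derive rho 1 (height m c) _ :=
  @is_derive1_comp _ _ (fun y => 1 - radius c y ^+ N) _ _ _ d3 d2.
apply: (is_derive_eq d4) => /=.
rewrite JintegrandE// (expr_div_n (radius c rho)).
have -> : (1 - radius c rho ^+ N) `^ (N%:R^-1 - 1) = height m c rho ^- N.-1.
  have -> : (N%:R^-1 - 1 : R) = N%:R^-1 * - N.-1%:R.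
    have NN : (N%:R : R) != 0 by rewrite pnatr_eq0 -lt0n.
    rewrite -[in RHS]subn1 natrB// mulrN mulrBr mulr1 mulVf// opprB//.
  by rewrite powRrM powR_invn ?powR_ge0// /height max_l// ltW.
have NN : (N%:R : R) != 0 by rewrite pnatr_eq0 -lt0n.
have hN : height m c rho ^+ N.-1 != 0 by rewrite expf_neq0// gt_eqF// height_gt0.
move: (N%:R : R) (radius c rho ^+ _) (height m c rho ^+ _) NN hN => C A B C0 B0.
by field; rewrite r0 B0 C0.
Qed.

Lemma continuous_radius rho : rho != 0 -> {for rho, continuous (radius c)}.
Proof. by move=> /is_derive_radius[/derivable1_diffP/differentiable_continuous]. Qed.

Lemma continuous_height rho : rho != 0 -> {for rho, continuous (height m c)}.
Proof.
move=> r0; have p0 : (0 : R) < N%:R^-1 by rewrite invr_gt0 ltr0n.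
apply: (@continuous_comp _ _ _ (fun y => 1 - radius c y ^+ N)
  (fun z => Num.max z 0 `^ N%:R^-1)); last first.
  exact: continuous_powR_max0.
apply: cvgB; first exact: cvg_cst.
apply: (@continuous_comp _ _ _ (radius c) (fun y => y ^+ N)).
  exact: continuous_radius.
exact: exprn_continuous.
Qed.

Lemma continuous_Jintegrand rho : b2 < rho < b3 -> {for rho, continuous h}.
Proof.
move=> rb; have rb' : b2 <= rho <= b3 by case/andP: rb => /ltW-> /ltW->.
have [b20 _ _ _] := b2b3.
have r0 : rho != 0 by rewrite gt_eqF//; case/andP: rb => + _; exact: lt_trans.
have /andP[rb2 rb3] := rb.
suff : (radius c y / height m c y) ^+ N.-1 @[y --> rho] --> h rho.
  apply: cvg_trans; apply: near_eq_cvg; near=> y; rewrite JintegrandE//.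
  by apply/andP; split; apply: ltW; near: y; [exact: lt_nbhsr|exact: lt_nbhsl].
rewrite JintegrandE//.
apply: (@continuous_comp _ _ _ (fun y => radius c y / height m c y)
  (fun y => y ^+ N.-1)); last exact: exprn_continuous.
apply: cvgM; first exact: continuous_radius.
by apply: cvgV; [rewrite gt_eqF// height_gt0|exact: continuous_height].
Unshelve. all: by end_near. Qed.

End Profile.

(** * The integral J *)

Section J.
Context {R : realType} (m : nat) (c : R).
Hypotheses (m0 : (0 < m)%N) (c0 : 0 < c) (c14 : c < 4^-1).
Implicit Types (rho x y : R).

Local Notation N := (2 * m)%N.
Local Notation b2 := (b2 c).
Local Notation b3 := (b3 c).
Local Notation h := (Jintegrand m c).
Local Notation mu := (@lebesgue_measure R).

Let N0 : (0 < N)%N. Proof. by rewrite muln_gt0. Qed.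

(* The right-hand side is the derivative of
   [rho |-> height rho * (sqrt c - rho) + K * rho]. The factor [sqrt c - rho] makes
   the first term nonnegative; it vanishes at [sqrt c] only, where the height is
   bounded away from 0, so that a large [K] takes over. *)
Lemma Jintegrand_le_derivative :
  exists (d K : R), 0 < d /\ forall rho, b2 <= rho <= b3 ->
    d * h rho <= (c / rho ^+ 2 - 1) * h rho * (Num.sqrt c - rho)
                 - height m c rho + K.
Proof.
have [b20 _ _ _] := b2b3 c0 c14.
set s := Num.sqrt c; have s0 : 0 < s by rewrite sqrtr_gt0.
have s2 : s ^+ 2 = c by rewrite sqr_sqrtr// ltW.
have c41 : 4 * c < 1 by rewrite mulrC -ltr_pdivlMr ?mul1r.
have s1 : 2 * s < 1 by nra.
(* The minimum of [radius] is [2 * s], attained at [s = sqrt c]; [d] is half of the gap between it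
   and 1. *)
pose d := (1 - 2 * s) / 2; have d0 : 0 < d by rewrite /d; lra.
have d1 : d < 1 by rewrite /d; lra.
pose M := d^-1 ^+ N.-1.
(* In [K], the 1 absorbs the height and [d * M] absorbs [d * h] wherever [h] is at most [M]. *)
exists d, (1 + d * M); split => // rho rb.
have r0 : 0 < rho by case/andP: rb => + _; exact: lt_le_trans.
have h0 := Jintegrand_ge0 m0 c0 c14 rb.
have /andP[t0 t1] := radius_le1 c0 c14 rb.
have z0 := height_ge0 m c rho.
have z1 := height_le1 m0 c0 c14 rb.
have hz := height_exp m0 c0 c14 rb.
have hE := JintegrandE m0 c0 c14 rb.
have A0 : radius c rho - 2 * s <= (c / rho ^+ 2 - 1) * (s - rho).
  have -> : radius c rho - 2 * s = (s - rho) ^+ 2 / rho.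
    by rewrite /radius -s2; field; rewrite gt_eqF.
  have -> : (c / rho ^+ 2 - 1) * (s - rho) = (s - rho) ^+ 2 / rho * (1 + s / rho).
    by rewrite -s2; field; rewrite gt_eqF.
  by rewrite ler_peMr ?divr_ge0 ?sqr_ge0 ?(ltW r0)// lerDl divr_ge0// ltW.
have A1 : 0 <= radius c rho - 2 * s.
  have -> : radius c rho - 2 * s = (s - rho) ^+ 2 / rho.
    by rewrite /radius -s2; field; rewrite gt_eqF.
  by rewrite divr_ge0 ?sqr_ge0 ?(ltW r0).
have M0 : 0 <= M by rewrite exprn_ge0// invr_ge0 ltW.
rewrite [_ * h rho * _]mulrAC; set A := (_ - 1) * _ in A0 *.
(* For radius at least [1 - d], the coefficient [A >= radius - 2 * s >= d] lets the first term
   dominate. Otherwise the height is bounded below and [h <= M]. *)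
have [td|td] := leP (1 - d) (radius c rho).
  have dA : d * h rho <= A * h rho.
    by apply: ler_wpM2r => //; apply: le_trans A0; rewrite /d in td *; lra.
  have dM : 0 <= d * M by rewrite mulr_ge0// ltW.
  move: (d * h rho) (A * h rho) (d * M) dA dM z1 => u v w; lra.
have Ah : 0 <= A * h rho by rewrite mulr_ge0// (le_trans A1).
suff dM : d * h rho <= d * M.
  move: (d * h rho) (A * h rho) (d * M) Ah dM z1 => u v w; lra.
apply: ler_wpM2l; first exact: ltW.
(* With both values in [[0, 1]], [height >= height ^ N = 1 - radius ^ N >= 1 - radius >= d]. *)
have dz : d <= height m c rho.
  have le1 (t : R) : 0 <= t -> t <= 1 -> t ^+ N <= t.
    by move=> ? ?; rewrite -{2}[t]expr1 ler_wiXn2l// .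
  apply: (le_trans _ (le1 _ z0 z1)).
  have := le1 _ (ltW t0) t1; lra.
have zp : 0 < height m c rho by exact: lt_le_trans dz.
rewrite hE /M; apply: lerXn2r; rewrite ?nnegrE ?invr_ge0 ?(ltW d0)//.
  exact: divr_ge0 (ltW t0) z0.
rewrite ler_pdivrMr//; apply: (le_trans t1).
by rewrite -[leLHS](mulVf (lt0r_neq0 d0)) ler_wpM2l// invr_ge0 ltW.
Qed.

(** The dominating function [f] is the derivative of [F], which is continuous up to the endpoints,
    so [integral_primitive_le] bounds its integral; then [h <= d^-1 * f]. *)
Lemma integrable_Jintegrand : mu.-integrable `[b2, b3] (EFin \o h).
Proof.
have [b20 b23 _ _] := b2b3 c0 c14.
have [d [K [d0 hf]]] := Jintegrand_le_derivative.
set f := (fun rho => (c / rho ^+ 2 - 1) * h rho * (Num.sqrt c - rho)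
                 - height m c rho + K).
pose F rho := height m c rho * (Num.sqrt c - rho) + K * rho.
have oc x : x \in `]b2, b3[ -> b2 < x < b3 by rewrite in_itv.
have oc' x : x \in `]b2, b3[ -> b2 <= x <= b3.
  by rewrite in_itv/= => /andP[/ltW-> /ltW->].
have x0 x : b2 <= x <= b3 -> x != 0.
  by move=> /andP[xb _]; rewrite gt_eqF// (lt_le_trans b20).
have ch : {in `]b2, b3[, continuous h}.
  by move=> x /oc; exact: continuous_Jintegrand.
have cF x : b2 <= x <= b3 -> {for x, continuous F}.
  move=> /x0 xn0; apply: cvgD.
    apply: cvgM; first exact: continuous_height.
    by apply: cvgB; [exact: cvg_cst|exact: cvg_id].
  by apply: cvgM; [exact: cvg_cst|exact: cvg_id].
have dF x : x \in `]b2, b3[ -> is_derive x 1 F (f x).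
  move=> /oc xb; have dh := is_derive_height m0 c0 c14 xb.
  by apply: is_derive_eq; rewrite /GRing.scale/= /f; ring.
have cf : {in `]b2, b3[, continuous f}.
  move=> x xb; apply: cvgD; last exact: cvg_cst.
  apply: cvgB; last by apply: continuous_height => //; exact: x0 (oc' _ xb).
  apply: cvgM; last by apply: cvgB; [exact: cvg_cst|exact: cvg_id].
  apply: cvgM; last exact: ch.
  apply: cvgB; last exact: cvg_cst.
  apply: cvgM; first exact: cvg_cst.
  by apply: cvgV; [rewrite expf_neq0// x0// oc'|exact: exprn_continuous].
have f0 x : b2 <= x <= b3 -> 0 <= f x.
  move=> xb; apply: le_trans (hf _ xb); apply: mulr_ge0; first exact: ltW.
  exact: Jintegrand_ge0.
(* Adding the two endpoints, where continuity may fail, preserves measurability. *)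
have meas (g : R -> R) : {in `]b2, b3[, continuous g} -> measurable_fun `[b2, b3] g.
  move=> cg; apply/measurable_fun_itv_bndo_bndcP/measurable_fun_itv_obnd_cbndP.
  apply: open_continuous_measurable_fun; first exact: interval_open.
  by move=> x; rewrite inE/=; exact: cg.
have intf : mu.-integrable `[b2, b3] (EFin \o f).
  apply/integrableP; split; first by apply/measurable_EFinP; exact: meas.
  apply: (@le_lt_trans _ _ (F b3 - F b2)%:E); last exact: ltry.
  under eq_integral.
    move=> x; rewrite inE/= in_itv/= => xb.
    rewrite ger0_norm ?f0//. over.
  apply: integral_primitive_le => //; first by move=> x /oc'; exact: f0.
  apply: continuous_in_subspaceT => x; rewrite inE/= in_itv/=; exact: cF.
apply: (@le_integrable _ _ _ mu _ _ _ (fun x => d^-1%:E * (EFin \o f) x)%E) => //.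
- by apply/measurable_EFinP; exact: meas.
- move=> x /=; rewrite in_itv/= => xb.
  rewrite lee_fin !ger0_norm; last 2 first.
  + by rewrite mulr_ge0 ?invr_ge0 ?(ltW d0)// f0.
  + exact: Jintegrand_ge0.
  by rewrite -[leLHS](mulKf (lt0r_neq0 d0)) ler_wpM2l ?invr_ge0 ?(ltW d0)// hf.
- exact: integrableZl.
Qed.

Lemma integrable_Jintegrand_sub x : x <= b3 ->
  mu.-integrable `[b2, x] (EFin \o h).
Proof.
move=> xb; apply: integrableS integrable_Jintegrand => //.
by apply: subset_itvl; rewrite bnd_simp.
Qed.

Lemma Jbar_fin_num x : b2 <= x <= b3 -> Jbar m c x \is a fin_num.
Proof.
by case/andP=> _ xb; apply: integrable_fin_num => //; exact: integrable_Jintegrand_sub.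
Qed.

Lemma J_b2 : J m c b2 = 0.
Proof. by rewrite /J /Jbar set_itv1 integral_set1. Qed.

Lemma continuous_J : {within `[b2, b3], continuous (J m c)}.
Proof.
have [b20 b23 _ _] := b2b3 c0 c14.
exact: (parameterized_integral_continuous (ltW b23) integrable_Jintegrand).
Qed.

Lemma is_derive_J x : b2 < x < b3 -> is_derive x 1 (J m c) (h x).
Proof.
move=> xb; have /andP[bx xb'] := xb.
have [dJ <-] := continuous_FTC1_closed xb' integrable_Jintegrand bx
  (continuous_Jintegrand m0 c0 c14 xb).
by rewrite derive1E; apply/derivableP.
Qed.

Lemma J_lt x y : b2 <= x -> x < y -> y <= b3 -> J m c x < J m c y.
Proof.
move=> bx xy yb.
have dJ t : t \in `]x, y[ -> is_derive t 1 (J m c) (h t).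
  rewrite in_itv/= => /andP[xt ty]; apply: is_derive_J.
  by rewrite (le_lt_trans bx)// (lt_le_trans ty).
have cJ : {within `[x, y], continuous (J m c)}.
  by apply: continuous_subspaceW continuous_J; apply: subset_itv; rewrite bnd_simp.
have [t] := MVT xy dJ cJ.
rewrite in_itv/= => /andP[xt ty] E; rewrite -subr_gt0 E mulr_gt0 ?subr_gt0//.
by apply: Jintegrand_gt0; rewrite ?(le_lt_trans bx)// (lt_le_trans ty).
Qed.

Lemma d2_gt0 : 0 < d2 m c.
Proof. by have [_ b23 _ _] := b2b3 c0 c14; rewrite -J_b2; apply: J_lt. Qed.

End J.

(** * The periodic meridian *)

Section Meridian.
Context {R : realType} (m : nat) (c c5 : R).
Hypotheses (m0 : (0 < m)%N) (c0 : 0 < c) (c14 : c < 4^-1).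
Implicit Types (rho x y t u : R).

Local Notation N := (2 * m)%N.
Local Notation b2 := (b2 c).
Local Notation b3 := (b3 c).
Local Notation h := (Jintegrand m c).
Local Notation D := (d2 m c).

Let D0 : 0 < D. Proof. exact: d2_gt0. Qed.
Let Dn0 : D != 0. Proof. exact: lt0r_neq0. Qed.
Let b23 : b2 < b3. Proof. by have [_ ] := b2b3 c0 c14. Qed.
Let b20 : 0 < b2. Proof. by have [] := b2b3 c0 c14. Qed.

Lemma J_bounds x : b2 <= x <= b3 -> 0 <= J m c x <= D.
Proof.
have Jle y z : b2 <= y -> y <= z -> z <= b3 -> J m c y <= J m c z.
  move=> b2y; rewrite le_eqVlt => /predU1P[->//|yz] zb3.
  exact: ltW (J_lt m0 c0 c14 b2y yz zb3).
by move=> /andP[b2x xb3]; rewrite -(J_b2 m c) !Jle.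
Qed.

Lemma J_inj x y : b2 <= x <= b3 -> b2 <= y <= b3 -> J m c x = J m c y -> x = y.
Proof.
move=> /andP[x1 x2] /andP[y1 y2] Jxy; have [xy|yx|//] := ltgtP x y.
  by have := J_lt m0 c0 c14 x1 xy y2; rewrite Jxy ltxx.
by have := J_lt m0 c0 c14 y1 yx x2; rewrite Jxy ltxx.
Qed.

Lemma J_surj t : 0 <= t <= D -> exists2 x, b2 <= x <= b3 & J m c x = t.
Proof.
move=> tD; have JJ : J m c b2 <= J m c b3 by rewrite J_b2 ltW.
have tJ : `[J m c b2, J m c b3]%classic t by rewrite /= in_itv/= J_b2.
have [x] := segment_continuous_le_surjective (ltW b23) JJ (continuous_J m0 c0 c14) tJ.
by rewrite /= in_itv/= => xb <-; exists x.
Qed.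

Definition Jcos x := cos (pi * (J m c x / D)).

Lemma Jangle_bounds x : b2 <= x <= b3 -> 0 <= pi * (J m c x / D) <= pi.
Proof.
move=> /J_bounds/andP[J0 JD]; rewrite mulr_ge0 ?pi_ge0 ?divr_ge0 ?(ltW D0)//=.
by rewrite ler_piMr ?pi_ge0// ler_pdivrMr// mul1r.
Qed.

Lemma Jcos_inj x y : b2 <= x <= b3 -> b2 <= y <= b3 -> Jcos x = Jcos y -> x = y.
Proof.
move=> xb yb /cos_inj; rewrite !in_itv/= !Jangle_bounds// => /(_ isT isT).
move=> /(mulfI (lt0r_neq0 (pi_gt0 R)))/(mulIf (invr_neq0 Dn0)).
exact: J_inj.
Qed.

Lemma Jcos_b2 : Jcos b2 = 1.
Proof. by rewrite /Jcos J_b2 mul0r mulr0 cos0. Qed.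

Lemma Jcos_b3 : Jcos b3 = -1.
Proof. by rewrite /Jcos -/D divff// mulr1 cospi. Qed.

Lemma continuous_Jcos : {within `[b2, b3], continuous Jcos}.
Proof.
move=> x; apply: (@continuous_comp (subspace `[b2, b3]) R R (J m c)
  (fun t => cos (pi * (t / D)))); first exact: continuous_J.
apply: (@continuous_comp _ _ _ (fun t => pi * (t / D)) cos);
  last exact: continuous_cos.
apply: cvgM; first exact: cvg_cst.
by apply: cvgM; [exact: cvg_id|exact: cvg_cst].
Qed.

Lemma is_derive_Jcos x : b2 < x < b3 ->
  is_derive x 1 Jcos (- sin (pi * (J m c x / D)) * (pi / D * h x)).
Proof.
move=> xb; have dJ := is_derive_J m0 c0 c14 xb.
have dA : is_derive x 1 (fun y => pi * (J m c y / D)) (pi / D * h x).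
  by apply: is_derive_eq; rewrite /GRing.scale/=; ring.
exact: (@is_derive1_comp _ cos (fun y => pi * (J m c y / D))).
Qed.

(** Outside [[-1, 1]] there is no preimage and the value is the default [b2]. *)
Definition Jcos_inv y := xget b2 [set x | b2 <= x <= b3 /\ Jcos x = y].

Lemma Jcos_invK y : -1 <= y <= 1 ->
  b2 <= Jcos_inv y <= b3 /\ Jcos (Jcos_inv y) = y.
Proof.
move=> y1; apply: (@xgetPex _ b2 [set x | b2 <= x <= b3 /\ Jcos x = y]).
(* Solving [pi * (J x / D) = acos y] for [J x] gives this value. *)
have [|x xb Jx] := @J_surj (acos y / pi * D).
  rewrite mulr_ge0 ?divr_ge0 ?acos_ge0 ?pi_ge0 ?(ltW D0)//=.
  by rewrite ler_piMl ?(ltW D0)// ler_pdivrMr ?pi_gt0// mul1r acos_lepi.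
exists x; split => //; rewrite /Jcos Jx mulfK// mulrC divfK ?acosK ?in_itv//.
exact: lt0r_neq0 (pi_gt0 R).
Qed.

Lemma JcosK x : b2 <= x <= b3 -> Jcos_inv (Jcos x) = x.
Proof.
move=> xb; have [|ib iE] := @Jcos_invK (Jcos x); last exact: Jcos_inj.
by rewrite cos_geN1 cos_le1.
Qed.

Lemma continuous_Jcos_inv : {within `[-1, 1], continuous Jcos_inv}.
Proof.
rewrite -Jcos_b3 -Jcos_b2; apply: (segment_can_ge_continuous (ltW b23) continuous_Jcos).
by move=> x; rewrite in_itv/=; exact: JcosK.
Qed.

Lemma sin_Jangle_gt0 x : b2 < x < b3 -> 0 < sin (pi * (J m c x / D)).
Proof.
move=> /andP[bx xb]; apply: sin_gt0_pi.
have J0 := J_lt m0 c0 c14 (lexx _) bx (ltW xb).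
have JD := J_lt m0 c0 c14 (ltW bx) xb (lexx _).
rewrite J_b2 in J0; rewrite mulr_gt0 ?pi_gt0 ?divr_gt0//=.
by rewrite gtr_pMr ?pi_gt0// ltr_pdivrMr// mul1r.
Qed.

(** Inverse function rule: in the open interval both the sine and the integrand are positive, so the
    derivative of [Jcos] does not vanish. *)
Lemma is_derive_Jcos_inv x : b2 < x < b3 ->
  is_derive (Jcos x) 1 Jcos_inv
    (- sin (pi * (J m c x / D)) * (pi / D * h x))^-1.
Proof.
move=> xb; have /andP[b2x xb3] := xb.
have nearb : \forall y \near x, b2 < y < b3.
  by near=> y; apply/andP; split; near: y; [exact: lt_nbhsr|exact: lt_nbhsl].
apply: is_derive_inverse.
- by apply: filterS nearb => y /andP[/ltW ? /ltW ?]; apply: JcosK; apply/andP.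
- apply: filterS nearb => y /is_derive_Jcos[+ _].
  by move=> /derivable1_diffP/differentiable_continuous.
- exact: is_derive_Jcos.
- rewrite mulf_neq0 ?oppr_eq0//; first exact/lt0r_neq0/sin_Jangle_gt0.
  apply: lt0r_neq0; apply: mulr_gt0; last exact: Jintegrand_gt0.
  by rewrite divr_gt0 ?pi_gt0.
Unshelve. all: by end_near. Qed.

Definition angle u := pi * ((u - c5) / D).

Lemma is_derive_angle u : is_derive u 1 angle (pi / D).
Proof. by rewrite /angle; apply: is_derive_eq; rewrite /GRing.scale/=; ring. Qed.

Lemma continuous_angle : continuous angle.
Proof.
move=> u; have [+ _] := is_derive_angle u.
by move=> /derivable1_diffP/differentiable_continuous.
Qed.

Definition meridian u := Jcos_inv (cos (angle u)).

(* The third coordinate of the Gauss map along the meridian; it changes sign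
   where the meridian turns back, so that it stays differentiable there. *)
Definition meridian_z u := Num.sg (sin (angle u)) * height m c (meridian u).

Lemma meridian_bounds u : b2 <= meridian u <= b3.
Proof. by have [] := @Jcos_invK (cos (angle u)); rewrite ?cos_geN1 ?cos_le1. Qed.

Lemma Jcos_meridian u : Jcos (meridian u) = cos (angle u).
Proof. by have [] := @Jcos_invK (cos (angle u)); rewrite ?cos_geN1 ?cos_le1. Qed.

Lemma meridian_neq0 u : meridian u != 0.
Proof.
by have /andP[h1 _] := meridian_bounds u; rewrite gt_eqF// (lt_le_trans b20).
Qed.

(** The two angles have the same cosine, hence sines of equal square; the left sine is nonnegative
    because its angle lies in [[0, pi]]. *)
Lemma sin_Jangle_meridian u :
  sin (pi * (J m c (meridian u) / D)) = `|sin (angle u)|.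
Proof.
have s0 := sin_ge0_pi (Jangle_bounds (meridian_bounds u)).
apply/eqP; rewrite -(@eqrXn2 _ 2)// real_normK ?num_real//; apply/eqP.
by rewrite !sin2cos2 -[cos (pi * _)]/(Jcos _) Jcos_meridian.
Qed.

(** At [b2] and [b3] the angle [pi * J / D] is 0 and [pi], where the sine vanishes. The turning
    points are therefore among the zeros of [sin (angle u)]. *)
Lemma meridian_interior u : sin (angle u) != 0 -> b2 < meridian u < b3.
Proof.
move=> s0; have /andP[h1 h2] := meridian_bounds u.
have sJ := sin_Jangle_meridian u; rewrite !lt_neqAle h1 h2 !andbT.
apply/andP; split; apply: contra s0 => /eqP E.
  by rewrite -normr_eq0 -sJ -E J_b2 mul0r mulr0 sin0.
by rewrite -normr_eq0 -sJ E -/D divff// mulr1 sinpi.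
Qed.

Lemma height_meridian0 u : sin (angle u) = 0 -> height m c (meridian u) = 0.
Proof.
move=> s0; have /andP[h1 h2] := meridian_bounds u.
have [mb2|mb2] := eqVneq (meridian u) b2; first by rewrite mb2 height_b2.
have [mb3|mb3] := eqVneq (meridian u) b3; first by rewrite mb3 height_b3.
have := @sin_Jangle_gt0 (meridian u).
rewrite sin_Jangle_meridian s0 normr0 ltxx => /(_ _)/eqP.
by rewrite !lt_neqAle h1 h2 mb3 eq_sym mb2 => /(_ isT).
Qed.

Lemma continuous_meridian : continuous meridian.
Proof.
apply: (@within_continuous_comp R Jcos_inv (fun u => cos (angle u)) (-1) 1).
- exact: continuous_Jcos_inv.
- move=> u; apply: (@continuous_comp _ _ _ angle cos).
    exact: continuous_angle.
  exact: continuous_cos.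
- by move=> u; rewrite in_itv/= cos_geN1 cos_le1.
Qed.

Lemma continuous_height_meridian : continuous (fun u => height m c (meridian u)).
Proof.
move=> u; apply: (@continuous_comp _ _ _ meridian (height m c)).
  exact: continuous_meridian.
exact/continuous_height/meridian_neq0.
Qed.

Lemma near_sg_sin u : sin (angle u) != 0 ->
  \forall y \near u, Num.sg (sin (angle y)) = Num.sg (sin (angle u)).
Proof.
move=> s0.
have cs : sin (angle y) @[y --> u] --> sin (angle u).
  apply: (@continuous_comp _ _ _ angle sin); first exact: continuous_angle.
  exact: continuous_sin.
move: s0; rewrite neq_lt => /orP[s0|s0].
  by near=> y; rewrite !ltr0_sg//; near: y; apply: (cvgr_lt (sin (angle u))).
by near=> y; rewrite !gtr0_sg//; near: y; apply: (cvgr_gt (sin (angle u))).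
Unshelve. all: by end_near. Qed.

(** Away from the zeros of the sine the sign is locally constant. At a zero, [|meridian_z|] is at
    most the height along the meridian, which tends to 0. *)
Lemma continuous_meridian_z : continuous meridian_z.
Proof.
move=> u; have [s0|s0] := eqVneq (sin (angle u)) 0.
  rewrite /continuous_at [X in _ --> X](_ : _ = 0); last first.
    by rewrite /meridian_z height_meridian0// mulr0.
  apply/cvgr0Pnorm_lt => e e0.
  have := continuous_height_meridian (x := u).
  rewrite /continuous_at height_meridian0// => /cvgr0Pnorm_lt/(_ e e0).
  apply: filterS => y; apply: le_lt_trans.
  rewrite /meridian_z normrM ler_piMl// normr_sg.
  by case: (_ != _).
have /near_sg_sin ns := s0.
suff : Num.sg (sin (angle u)) * height m c (meridian y) @[y --> u] --> meridian_z u.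
  apply: cvg_trans; apply: near_eq_cvg; apply: filterS ns => y yu.
  by rewrite /meridian_z yu.
by apply: cvgM; [exact: cvg_cst|exact: continuous_height_meridian].
Qed.

Lemma sphere_meridian u :
  meridian_z u ^+ N + radius c (meridian u) ^+ N = 1.
Proof.
rewrite -(height_exp m0 c0 c14 (meridian_bounds u)); congr (_ + _).
(* The sign factor is 0 here and its even power is not 1, but the height vanishes as well. *)
have [s0|s0] := eqVneq (sin (angle u)) 0.
  by rewrite /meridian_z height_meridian0// mulr0.
by rewrite /meridian_z exprMn exprM sqr_sg s0 expr1n mul1r.
Qed.

Lemma radius_meridian_gt0 u : 0 < radius c (meridian u).
Proof. by have /andP[] := radius_le1 c0 c14 (meridian_bounds u). Qed.

Lemma sin_angle_neq0_dnbhs u : \forall y \near u^', sin (angle y) != 0.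
Proof.
have := sin_neq0_dnbhs (angle u); rewrite !near_withinE => sn.
apply: (@filterS _ (nbhs u) _ _ _ _ (continuous_angle sn)) => y /= h' yu.
apply: h'; apply: contra yu => /eqP.
by move=> /(mulfI (lt0r_neq0 (pi_gt0 R)))/(mulIf (invr_neq0 Dn0)) /addIr ->.
Qed.

(** The exponent [N - 1] is odd, so the sign survives the power. *)
Lemma meridian_slope u : sin (angle u) != 0 ->
  (meridian_z u / radius c (meridian u)) ^+ N.-1 =
  Num.sg (sin (angle u)) / h (meridian u).
Proof.
move=> s0; rewrite JintegrandE ?meridian_bounds// /meridian_z -mulrA exprMn.
rewrite -[in RHS]exprVn (invf_div (radius c _)); congr (_ * _).
have -> : N.-1 = (2 * m.-1).+1 by move: m0; case: (m) => // k _; rewrite mulnS.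
by rewrite exprSr exprM sqr_sg s0 expr1n mul1r.
Qed.

(** Chain rule through [Jcos_inv], the cosine and the angle: the factors [pi / D] cancel, and
    [sin / |sin|] leaves the sign. *)
Lemma is_derive_meridian_off u : sin (angle u) != 0 ->
  is_derive u 1 meridian ((meridian_z u / radius c (meridian u)) ^+ N.-1).
Proof.
move=> s0; have rb := meridian_interior s0.
have := is_derive_Jcos_inv rb; rewrite Jcos_meridian sin_Jangle_meridian => d1.
have d2 := @is_derive1_comp _ cos angle _ _ _ (is_derive_cos _) (is_derive_angle u).
have d3 := @is_derive1_comp _ Jcos_inv (cos \o angle) _ _ _ d1 d2.
apply: (is_derive_eq d3); rewrite meridian_slope//.
have hn0 : h (meridian u) != 0 by rewrite lt0r_neq0// Jintegrand_gt0.
have sn0 : `|sin (angle u)| != 0 by rewrite normr_eq0.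
rewrite {2}[sin (angle u)]numEsg.
have pin0 : (pi : R) != 0 by rewrite lt0r_neq0// pi_gt0.
move: (Num.sg _) (h _) `|_| (pi : R) D hn0 sn0 pin0 Dn0 => a b d e f b0 d0 e0 f0.
by field; rewrite b0 d0 e0 f0.
Qed.

(** The formula holds off the zeros of the sine, which are isolated, and its right-hand side is
    continuous everywhere; [continuous_is_derive] extends it to the turning points. *)
Lemma is_derive_meridian u : is_derive u 1 meridian
  ((meridian_z u / radius c (meridian u)) ^+ N.-1).
Proof.
pose g y := (meridian_z y / radius c (meridian y)) ^+ N.-1.
apply: (@continuous_is_derive _ meridian g u).
- exact: continuous_meridian.
- apply: (@continuous_comp _ _ _ (fun y => meridian_z y / radius c (meridian y))
    (fun y => y ^+ N.-1)); last exact: exprn_continuous.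
  apply: cvgM; first exact: continuous_meridian_z.
  apply: cvgV; first exact: lt0r_neq0 (radius_meridian_gt0 _).
  apply: (@continuous_comp _ _ _ meridian (radius c)).
    exact: continuous_meridian.
  exact/continuous_radius/meridian_neq0.
- by apply: filterS (sin_angle_neq0_dnbhs u) => y; exact: is_derive_meridian_off.
Qed.

(** Off the zeros of the sine, the integrand in the derivative of the height cancels against the
    slope, and the two signs multiply to 1. The zeros are crossed as for [meridian]. *)
Lemma is_derive_meridian_z u : is_derive u 1 meridian_z (c / meridian u ^+ 2 - 1).
Proof.
apply: (@continuous_is_derive _ meridian_z (fun y => c / meridian y ^+ 2 - 1) u).
- exact: continuous_meridian_z.
- apply: cvgB; last exact: cvg_cst.
  apply: cvgM; first exact: cvg_cst.
  apply: cvgV; first by rewrite expf_neq0// meridian_neq0.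
  apply: (@continuous_comp _ _ _ meridian (fun y => y ^+ 2)).
    exact: continuous_meridian.
  exact: exprn_continuous.
apply: filterS (sin_angle_neq0_dnbhs u) => y s0.
have rb := meridian_interior s0.
have d1 := is_derive_height m0 c0 c14 rb.
have d2 := is_derive_meridian_off s0.
have d3 := @is_derive1_comp _ (height m c) meridian _ _ _ d1 d2.
have d4 := @is_deriveZ _ _ _ _ (Num.sg (sin (angle y))) _ _ _ d3.
apply: (@near_eq_is_derive _ _ _
  (fun t => Num.sg (sin (angle y)) * height m c (meridian t))).
  by apply: filterS (near_sg_sin s0) => t ty; rewrite /meridian_z ty.
apply: (is_derive_eq d4); rewrite /GRing.scale/= meridian_slope//.
have hn0 : h (meridian y) != 0 by rewrite lt0r_neq0// Jintegrand_gt0.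
have sg2 : Num.sg (sin (angle y)) * Num.sg (sin (angle y)) = 1.
  by rewrite -expr2 sqr_sg s0.
move: (Num.sg _) (h _) sg2 hn0 (meridian_neq0 y) => a b a2 b0 r0.
transitivity (a * a * (c / meridian y ^+ 2 - 1)); last by rewrite a2 mul1r.
by field; rewrite b0 r0.
Qed.

End Meridian.

(** * The meridian as the unique solution of the defining prescription *)

Section MeridianSpec.
Context {R : realType} (m : nat) (c c5 : R).
Hypotheses (m0 : (0 < m)%N) (c0 : 0 < c) (c14 : c < 4^-1).

Local Notation D := (d2 m c).
Local Notation alpha := (meridian m c c5).

Let D0 : 0 < D. Proof. exact: d2_gt0. Qed.
Let Dn0 : D != 0. Proof. exact: lt0r_neq0. Qed.

(** A shift by [k] periods adds [2 * k * pi] to the angle, and evenness of the cosine replaces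
    [u - c5] by its absolute value. Both angles then lie in [[0, pi]], where the cosine is
    injective. *)
Lemma meridian_spec : alpha_star_spec m c c5 alpha.
Proof.
move=> u k uD; have xb := meridian_bounds c5 m0 c0 c14 (u + 2 * k%:~R * D).
split=> //; have := Jcos_meridian c5 m0 c0 c14 (u + 2 * k%:~R * D).
have -> : angle m c c5 (u + 2 * k%:~R * D) = pi * ((u - c5) / D) + 2 * k%:~R * pi.
  by rewrite /angle; field.
have u0 : 0 <= `|u - c5| / D <= 1.
  rewrite divr_ge0 ?(ltW D0)//= ler_pdivrMr// mul1r ler_norml.
  by move: uD => /andP[h1 h2]; apply/andP; split; lra.
rewrite cosD2pi_int -[cos (pi * ((u - c5) / D))]cos_norm.
rewrite normrM (ger0_norm (pi_ge0 R)) normrM [`|D^-1|]gtr0_norm ?invr_gt0//.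
move=> /cos_inj; rewrite !in_itv/= Jangle_bounds//.
rewrite mulr_ge0 ?pi_ge0//; last by case/andP: u0.
rewrite ler_piMr ?pi_ge0//; last by case/andP: u0.
by move=> /(_ isT isT)/(mulfI (lt0r_neq0 (pi_gt0 R)))/(mulIf (invr_neq0 Dn0)).
Qed.

Lemma alpha_star_spec_unique (g : R -> R) : alpha_star_spec m c c5 g -> g = alpha.
Proof.
move=> gspec; apply/funext => w.
(* Subtracting [k] periods brings [w] into the fundamental interval, where injectivity of [J]
   decides. *)
pose k := Num.floor ((w - c5 + D) / (2 * D)).
pose u := w - 2 * k%:~R * D.
have wu : w = u + 2 * k%:~R * D by rewrite subrK.
have uD : c5 - D <= u <= c5 + D.
  have D20 : 0 < 2 * D by rewrite mulr_gt0.
  have h1 := floor_le ((w - c5 + D) / (2 * D)).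
  have h2 := floorD1_gt ((w - c5 + D) / (2 * D)).
  rewrite ler_pdivlMr// in h1; rewrite ltr_pdivrMr// intrD in h2.
  rewrite -/k in h1 h2; rewrite /u; move: (k%:~R : R) h1 h2 => K h1 h2.
  by apply/andP; split; nra.
have [gb gJ] := gspec u k uD; have [ab aJ] := meridian_spec k uD.
by rewrite wu; apply: (J_inj m0 c0 c14) => //; rewrite gJ aJ.
Qed.

Lemma meridian_periodic u : alpha (u + 2 * D) = alpha u.
Proof.
rewrite /meridian; congr Jcos_inv; rewrite -[RHS](cosD2pi_int _ 1); congr cos.
by rewrite /angle; field.
Qed.

End MeridianSpec.

(** * The rotational surface *)

Section RotationalSurface.
Context {R : realType} (m : nat) (c : R) (a z : R -> R).
Hypotheses (m0 : (0 < m)%N) (c0 : 0 < c).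
Hypothesis a_gt0 : forall u : R, 0 < a u.

Local Notation N := (2 * m)%N.
Local Notation r u := (radius c (a u)).
Local Notation slope u := ((z u / radius c (a u)) ^+ (2 * m).-1).
Local Notation dz u := (c / a u ^+ 2 - 1).

Hypothesis sphere : forall u : R, z u ^+ N + r u ^+ N = 1.
Hypothesis is_derive_a : forall u : R, is_derive u 1 a (slope u).
Hypothesis is_derive_z : forall u : R, is_derive u 1 z (dz u).

Let an0 (u : R) : a u != 0. Proof. exact: lt0r_neq0. Qed.

Let r_gt0 (u : R) : 0 < r u.
Proof. by rewrite /radius divr_gt0// addr_gt0// exprn_gt0. Qed.

Let rn0 (u : R) : r u != 0. Proof. exact: lt0r_neq0. Qed.

Let is_derive_r (u : R) : is_derive u 1 (fun t => r t) (- (dz u * slope u)).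
Proof.
have d := @is_derive1_comp _ (radius c) a _ _ _
  (is_derive_radius c (an0 u)) (is_derive_a u).
by apply: (is_derive_eq d); ring.
Qed.

Let ca : continuous a. Proof. by move=> u; exact: is_derive_continuous. Qed.
Let cz : continuous z. Proof. by move=> u; exact: is_derive_continuous. Qed.
Let cr : continuous (fun u => r u).
Proof. by move=> u; exact: is_derive_continuous. Qed.

Let cquot : continuous (fun u => z u / r u).
Proof. by move=> u; apply: cvgM; [exact: cz|apply: cvgV; [exact: rn0|exact: cr]]. Qed.

Let cquotX n : continuous (fun u => (z u / r u) ^+ n).
Proof.
move=> u; apply: (@continuous_comp _ _ _ (fun u => z u / r u) (fun x => x ^+ n)).
  exact: cquot.
exact: exprn_continuous.
Qed.

Let cdz : continuous (fun u => dz u).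
Proof.
move=> u; apply: cvgB; last exact: cvg_cst.
apply: cvgM; first exact: cvg_cst.
apply: cvgV; first by rewrite expf_neq0.
apply: (@continuous_comp _ _ _ a (fun x => x ^+ 2)); first exact: ca.
exact: exprn_continuous.
Qed.

(** The slope [(z / r) ^ (N - 1)] is built from the differentiable functions [z] and [r] with
    [r > 0], so the system itself can be differentiated once more, with a continuous result. *)
Lemma C2fun_profile : C2fun a.
Proof.
have da : derive1 a = fun u => slope u.
  by apply/funext => u; exact: is_derive_derive1.
have dquot (u : R) : is_derive u 1 (fun t => z t / r t)
    (dz u / r u + z u * (dz u * slope u) / r u ^+ 2).
  have dV := @is_deriveV _ (fun t => r t) _ _ _ (rn0 u) (is_derive_r u).
  have d := is_deriveM (is_derive_z u) dV.
  apply: (is_derive_eq d); rewrite /GRing.scale/=.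
  by move: (slope u) (dz u) (r u) (rn0 u) => A B q q0; field.
have dslope u := is_derive_exp N.-1 (dquot u).
split; first by move=> u; case: (is_derive_a u).
split; first by move=> u; rewrite da; case: (dslope u).
rewrite [X in continuous X](_ : _ = fun u => N.-1%:R * (z u / r u) ^+ N.-1.-1 *
   (dz u / r u + z u * (dz u * slope u) / r u ^+ 2)); last first.
  by apply/funext => u; rewrite da (is_derive_derive1 (dslope u)).
move=> u; apply: cvgM.
  by apply: cvgM; [exact: cvg_cst|exact: cquotX].
apply: cvgD.
  by apply: cvgM; [exact: cdz|apply: cvgV; [exact: rn0|exact: cr]].
apply: cvgM; last first.
  apply: cvgV; first by rewrite expf_neq0.
  apply: (@continuous_comp _ _ _ (fun t => r t) (fun x => x ^+ 2)); first exact: cr.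
  exact: exprn_continuous.
by apply: cvgM; [exact: cz|apply: cvgM; [exact: cdz|exact: cquotX]].
Qed.

Lemma pu_fstar u v :
  pu (fstar a) u v = mkv3 (slope u * cos v) (slope u * sin v) 1.
Proof.
have da := is_derive_a u.
rewrite /pu /mkv3; congr (_, _, _); apply: is_derive_derive1.
- by apply: is_derive_eq; rewrite /GRing.scale/=; ring.
- by apply: is_derive_eq; rewrite /GRing.scale/=; ring.
Qed.

Lemma pv_fstar u v :
  pv (fstar a) u v = mkv3 (- (a u * sin v)) (a u * cos v) 0.
Proof.
rewrite /pv /mkv3; congr (_, _, _); apply: is_derive_derive1; last exact: is_derive_cst.
all: by apply: is_derive_eq; rewrite /GRing.scale/=; ring.
Qed.

Lemma cross_fstar u v : cross (pu (fstar a) u v) (pv (fstar a) u v) =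
  mkv3 (- (a u * cos v)) (- (a u * sin v)) (a u * slope u).
Proof.
rewrite pu_fstar pv_fstar /cross /mkv3 /c1 /c2 /c3v/=; congr (_, _, _).
- by ring.
- by ring.
- rewrite -[RHS]mulr1 -(cos2Dsin2 v); ring.
Qed.

Definition rotational_gauss u v : v3 R :=
  mkv3 (- r u * cos v) (- r u * sin v) (z u).

Let NE : N = N.-1.+1. Proof. by rewrite prednK// muln_gt0. Qed.
Let NE2 : N.-1 = (2 * m.-1).+1.
Proof. by move: m0; case: m => // k _; rewrite mulnS. Qed.

Let polar (k v : R) : (- k * cos v) ^+ 2 + (- k * sin v) ^+ 2 = k ^+ 2.
Proof. by rewrite -[RHS]mulr1 -(cos2Dsin2 v); ring. Qed.

Lemma rotational_gauss_BG : is_BG_map m (fstar a) rotational_gauss.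
Proof.
move=> u v; split.
  by rewrite /Phi /rotational_gauss /c1 /c2 /c3v/= polar -exprM addrC sphere.
have Nn0 : N%:R != 0 :> R by rewrite pnatr_eq0 NE.
(* Comparing the horizontal components, [N * r ^ (N - 2) * r = mu * a]. *)
exists (N%:R * r u ^+ N.-1 / a u); split.
  by rewrite divr_gt0// mulr_gt0 ?exprn_gt0// ltr0n NE.
rewrite cross_fstar /gradPhi /scalev3 /rotational_gauss /mkv3 /c1 /c2 /c3v/= polar.
rewrite -exprM (expr_div_n (z u)) NE2 !exprS.
move: (_ ^+ _) (r u ^+ _) (expf_neq0 (2 * m.-1) (rn0 u)) => A B B0.
by congr (_, _, _); field; rewrite ?an0 ?rn0 ?B0.
Qed.

(** The horizontal equations give [(x1, x2) = - k * (cos v, sin v)] with [k > 0], the third gives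
    [x3 = k * z / r] by injectivity of odd powers, and the sphere equation forces [k = r]. *)
Lemma rotational_gauss_unique eta :
  is_BG_map m (fstar a) eta -> eta = rotational_gauss.
Proof.
move=> BG; apply/funext => u; apply/funext => v.
have [P1 [mu [mu0]]] := BG u v; rewrite cross_fstar.
move: P1; rewrite /Phi /gradPhi /scalev3 /rotational_gauss /mkv3.
case: (eta u v) => [[x1 x2] x3]; rewrite /c1 /c2 /c3v/= => P1 [E1 E2 E3].
have Nn0 : N%:R != 0 :> R by rewrite pnatr_eq0 NE.
set s := x1 ^+ 2 + x2 ^+ 2 in P1 E1 E2.
have s0 : 0 <= s by rewrite addr_ge0 ?sqr_ge0.
set q := N%:R * s ^+ m.-1 in E1 E2.
have ma0 : 0 < mu * a u by rewrite mulr_gt0.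
have q0 : 0 < q.
  rewrite lt_neqAle eq_sym mulr_ge0 ?exprn_ge0 ?ler0n// andbT.
  (* If [q] were 0, both [cos v] and [sin v] would vanish. *)
  apply/eqP => q0; have van0 t w : q * w = mu * - (a u * t) -> t = 0.
    rewrite q0 mul0r mulrN mulrA => /esym/eqP.
    by rewrite oppr_eq0 mulf_eq0 gt_eqF//= => /eqP.
  have := cos2Dsin2 v; rewrite (van0 _ _ E1) (van0 _ _ E2).
  by rewrite expr0n addr0 => /esym/eqP; rewrite oner_eq0.
have qn0 := lt0r_neq0 q0.
pose k := mu * a u / q; have k0 : 0 < k by rewrite divr_gt0.
have X1 : x1 = - k * cos v.
  by apply: (mulfI qn0); rewrite E1 /k; field.
have X2 : x2 = - k * sin v.
  by apply: (mulfI qn0); rewrite E2 /k; field.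
have sk : s = k ^+ 2 by rewrite /s X1 X2 polar.
have Nk : N%:R * k ^+ N.-1 = mu * a u.
  have -> : mu * a u = q * k by rewrite /k mulrCA divff ?mulr1.
  by rewrite /q sk -exprM NE2 exprSr mulrA.
clearbody k.
have X3 : x3 = k * (z u / r u).
  apply: (@expr_odd_inj _ N.-1); first by rewrite NE2 /= mul2n odd_double.
  by apply: (mulfI Nn0); rewrite E3 [in RHS]exprMn !mulrA Nk.
(* Both [(k, x3)] and [(r, z)] satisfy the sphere equation, and the former is [k / r] times the
   latter. *)
have kr : k = r u.
  apply/eqP; rewrite -(@eqrXn2 _ N) ?(ltW k0) ?(ltW (r_gt0 u))//; last by rewrite NE.
  apply/eqP; move: P1; rewrite sk -exprM X3 exprMn (expr_div_n (z u)) => P1.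
  have rN0 := expf_neq0 N (rn0 u).
  have : k ^+ N * (z u ^+ N + r u ^+ N) = r u ^+ N.
    by rewrite -[RHS]mul1r -[in RHS]P1; field.
  by rewrite sphere mulr1.
by rewrite X1 X2 X3 kr mulrCA divff ?mulr1.
Qed.

Lemma rotational_gauss_C1 : C1_map rotational_gauss.
Proof.
have dNr (u : R) : is_derive u 1 (fun t => - r t) (dz u * slope u).
  by have d := is_deriveN (is_derive_r u); apply: (is_derive_eq d); rewrite opprK.
have cNr : continuous (fun u => dz u * slope u).
  by move=> u; apply: cvgM; [exact: cdz|exact: cquotX].
split; [|split].
- apply: (C1_2d_mul dNr (fun v => is_derive_cos v) cNr) => v.
  by apply: cvgN; exact: continuous_sin.
- by apply: (C1_2d_mul dNr (fun v => is_derive_sin v) cNr); exact: continuous_cos.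
- have -> : (fun u v => c3v (rotational_gauss u v)) = fun u v => z u * cst 1 v.
    by apply/funext => u; apply/funext => v; rewrite mulr1.
  apply: (C1_2d_mul is_derive_z (fun v => is_derive_cst _ _ _) cdz).
  exact: cst_continuous.
Qed.

Lemma rotational_gauss_curvature u v :
  mink_mean_curv (fstar a) rotational_gauss u v (-1).
Proof.
have dr := is_derive_r u; have dzu := is_derive_z u.
have puE : pu rotational_gauss u v =
    mkv3 (dz u * slope u * cos v) (dz u * slope u * sin v) (dz u).
  rewrite /pu /mkv3; congr (_, _, _); apply: is_derive_derive1 => //.
  - by apply: is_derive_eq; rewrite /GRing.scale/=; ring.
  - by apply: is_derive_eq; rewrite /GRing.scale/=; ring.
have pvE : pv rotational_gauss u v = mkv3 (r u * sin v) (- r u * cos v) 0.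
  have dcos := is_deriveM (is_derive_cst (- r u) v 1) (is_derive_cos v).
  have dsin := is_deriveM (is_derive_cst (- r u) v 1) (is_derive_sin v).
  rewrite /pv (is_derive_derive1 dcos) (is_derive_derive1 dsin).
  rewrite (is_derive_derive1 (is_derive_cst (z u) v 1)) /mkv3 /GRing.scale/=.
  by congr (_, _, _); ring.
(* The differential is diagonal in the basis [f_u], [f_v]; its trace is
   [(c / a ^ 2 - 1) - (c / a ^ 2 + 1) = -2]. *)
exists (dz u), 0, 0, (- (r u / a u)).
rewrite puE pvE pu_fstar pv_fstar /addv3 /scalev3 /mkv3 /c1 /c2 /c3v/=.
split; [|split].
- by congr (_, _, _); ring.
- by congr (_, _, _); field.
- by rewrite /radius; field.
Qed.

End RotationalSurface.

Theorem theorem6p2 (R : realType) (m : nat) (c3 c5 : R) :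
  (2 <= m)%N -> 0 < c3 -> c3 < 4^-1 ->
  (* J is finite and strictly increasing on [b2,b3], d2 > 0 *)
  (forall alpha : R, b2 c3 <= alpha <= b3 c3 -> Jbar m c3 alpha \is a fin_num) /\
  (forall x y : R, b2 c3 <= x -> x < y -> y <= b3 c3 -> J m c3 x < J m c3 y) /\
  0 < d2 m c3 /\
  (* hat-alpha is well defined *)
  (forall u : R, c5 - d2 m c3 <= u <= c5 + d2 m c3 ->
     exists! alpha : R, (b2 c3 <= alpha <= b3 c3) /\ J m c3 alpha = `|u - c5|) /\
  (* alpha* is well defined, 2 d2-periodic, C^2, and f* has a C^1
     Birkhoff-Gauss map with constant Minkowski mean curvature -1 *)
  exists astar : R -> R,
    alpha_star_spec m c3 c5 astar /\
    (forall g : R -> R, alpha_star_spec m c3 c5 g -> g = astar) /\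
    (forall u : R, astar (u + 2 * d2 m c3) = astar u) /\
    C2fun astar /\
    (exists eta : R -> R -> v3 R, is_BG_map m (fstar astar) eta) /\
    (forall eta : R -> R -> v3 R, is_BG_map m (fstar astar) eta ->
       C1_map eta /\
       forall u v : R, mink_mean_curv (fstar astar) eta u v (-1)).
Proof.
move=> m2 c0 c14; have m0 : (0 < m)%N by exact: ltnW.
have [b20 _ _ _] := b2b3 c0 c14.
split; first by move=> alpha; exact: Jbar_fin_num.
split; first by move=> x y; exact: J_lt.
split; first exact: d2_gt0.
split.
  move=> u uD; have [x xb Jx] : exists2 x, b2 c3 <= x <= b3 c3 & J m c3 x = `|u - c5|.
    apply: J_surj => //; rewrite normr_ge0 ler_norml.
    by move: uD => /andP[h1 h2]; apply/andP; split; lra.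
  exists x; split=> // y [yb Jy]; apply: (J_inj m0 c0 c14) => //.
  by rewrite Jx Jy.
pose alpha := meridian m c3 c5; pose z := meridian_z m c3 c5.
have alpha0 u : 0 < alpha u.
  have /andP[+ _] := meridian_bounds c5 m0 c0 c14 u; exact: lt_le_trans.
have sph : forall u, z u ^+ (2 * m) + radius c3 (alpha u) ^+ (2 * m) = 1.
  exact: sphere_meridian.
have dalpha (u : R) : is_derive u 1 alpha ((z u / radius c3 (alpha u)) ^+ (2 * m).-1).
  exact: is_derive_meridian.
have dz (u : R) : is_derive u 1 z (c3 / alpha u ^+ 2 - 1).
  exact: is_derive_meridian_z.
exists alpha; split; first exact: meridian_spec.
split; first exact: alpha_star_spec_unique.
split; first exact: meridian_periodic.
split; first exact: (C2fun_profile c0 alpha0 dalpha dz).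
split.
  exists (rotational_gauss c3 alpha z).
  exact: rotational_gauss_BG.
(* By uniqueness, every Birkhoff-Gauss map is the explicit one. *)
move=> eta /(rotational_gauss_unique m0 c0 alpha0 sph dalpha) ->; split.
  exact: (rotational_gauss_C1 c0 alpha0 dalpha dz).
exact: rotational_gauss_curvature.
Qed.
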